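(* Let $f(x,y)$ be a polynomial in two variables with real coefficients satisfying $$f(x, y) > 0 \text{ for all real } x\geq 0,\ y\geq0,$$ $$f(\infty, y) > 0 \text{ for all real } y\geq0,$$ $$f(x, \infty) > 0 \text{ for all real } x\geq0,$$ $$f(\infty, \infty) > 0.$$ Then there exist polynomials $f_1(x,y)$ and $f_2(x,y)$ with nonnegative real coefficients, $f_1\neq 0$, such that $$f(x,y) = \dfrac{f_2(x,y)}{f_1(x,y)}.$$
   Context: Let $f(x,y)$ be a nonzero real polynomial of degree $n_1$ in $x$ and degree $n_2$ in $y$ (that is, $n_1$ and $n_2$ are the highest powers of $x$ and of $y$ occurring in $f$). Then $f(\infty,y)$ denotes the polynomial in $y$ that is the coefficient of $x^{n_1}$ in $f$, i.e. $f(\infty,y)=\lim_{x\to\infty} f(x,y)/x^{n_1}$. Likewise $f(x,\infty)$ denotes the polynomial in $x$ that is the coefficient of $y^{n_2}$ in $f$. Finally, $f(\infty,\infty)$ denotes the coefficient of the monomial $x^{n_1}y^{n_2}$ in $f$. *)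

(* Defs.v *)
From mathcomp Require Import all_boot all_order all_algebra.
From mathcomp Require Import reals.

Set Implicit Arguments.
Unset Strict Implicit.
Unset Printing Implicit Defensive.

Import Order.TTheory GRing.Theory Num.Theory.
Local Open Scope ring_scope.

(* A bivariate polynomial f(x, y) is an element of {poly {poly R}}: as in
   polyXY, x is the outer variable and y the inner one, so that f.[x, y] is the
   value of f at (x, y) and f`_i`_j is the coefficient of x^i y^j. *)

Definition degX (R : realType) (f : {poly {poly R}}) : nat := (size f).-1.

Definition degY (R : realType) (f : {poly {poly R}}) : nat := (sizeY f).-1.

(* f(oo, y), a polynomial in y: the coefficient of x^(degX f) *)
Definition at_inftyX (R : realType) (f : {poly {poly R}}) : {poly R} :=
  f`_(degX f).

(* f(x, oo), a polynomial in x: the coefficient of y^(degY f); swapXY f is f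
   regarded as a polynomial in y with coefficients in R[x] *)
Definition at_inftyY (R : realType) (f : {poly {poly R}}) : {poly R} :=
  (swapXY f)`_(degY f).

(* f(oo, oo). This may be 0: x^(degX f) y^(degY f) need not occur in f. *)
Definition at_inftyXY (R : realType) (f : {poly {poly R}}) : R :=
  f`_(degX f)`_(degY f).

Definition nneg_coefs (R : realType) (f : {poly {poly R}}) : Prop :=
  forall i j : nat, 0 <= f`_i`_j.

Notation "p %:F" := (@FracField.tofrac _ p) : ring_scope.

(* Main.v *)
Require Import Defs.
From mathcomp Require Import all_boot all_order all_algebra.
From mathcomp Require Import ring zify.
From mathcomp Require Import reals classical_sets topology normedtype sequences.

Import Order.TTheory GRing.Theory Num.Theory.
Import numFieldNormedType.Exports.
Local Open Scope ring_scope.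

(* Polya's argument on a product of two intervals, with the multiplier
   f1 = (1 + x)^N1 (1 + y)^N2.  Substituting x = s / (1 - s), y = t / (1 - t)
   and clearing denominators turns the four positivity assumptions into the
   positivity of the single polynomial
     F(s, t) = sum_ij a_ij s^i (1-s)^(n1-i) t^j (1-t)^(n2-j)
   on the compact square [0, 1]^2.  For m = N1 + n1 = N2 + n2, the coefficient
   of x^k y^l in f f1 is a positive multiple of the value at (k/m, l/m) of the
   perturbation of F in which powers are replaced by falling factorials of step
   1/m.  The perturbed polynomial is jointly continuous in (s, t) and the step,
   so it stays positive on the square once m is large. *)

(** * The perturbed polynomials, and positivity in one variable at step zero *)

Definition hom_monomial {R : pzRingType} (n i : nat) (s e : R) : R :=
  (\prod_(u < i) (s - u%:R * e)) * \prod_(u < n - i) (1 - s - u%:R * e).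

Definition hom_eval {R : nzRingType} (n : nat) (p : {poly R}) (s e : R) : R :=
  \sum_(i < n.+1) p`_i * hom_monomial n i s e.

Definition hom_eval2 {R : nzRingType} (n1 n2 : nat) (f : {poly {poly R}})
    (s t e : R) : R :=
  \sum_(i < n1.+1) hom_eval n2 f`_i t e * hom_monomial n1 i s e.

Lemma hom_monomial0 (R : comPzRingType) n i (s : R) :
  hom_monomial n i s 0 = s ^+ i * (1 - s) ^+ (n - i).
Proof.
rewrite /hom_monomial; under eq_bigr do rewrite mulr0 subr0.
under [X in _ * X]eq_bigr do rewrite mulr0 subr0.
by rewrite !prodr_const !card_ord.
Qed.

Lemma hom_eval_lt1 (R : fieldType) n (p : {poly R}) (s : R) :
  (size p <= n.+1)%N -> 1 - s != 0 ->
  hom_eval n p s 0 = (1 - s) ^+ n * p.[s / (1 - s)].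
Proof.
move=> szp s1; rewrite (horner_coef_wide _ szp) mulr_sumr; apply: eq_bigr => i _.
rewrite hom_monomial0 [RHS]mulrCA; congr (_ * _); rewrite expr_div_n.
have le_in : (i <= n)%N by rewrite -ltnS.
have -> : (1 - s) ^+ n = (1 - s) ^+ (n - i) * (1 - s) ^+ i by rewrite -exprD subnK.
by rewrite [RHS]mulrACA divff ?mulr1 ?expf_neq0// mulrC.
Qed.

Lemma hom_eval_at1 (R : comNzRingType) n (p : {poly R}) :
  hom_eval n p 1 0 = p`_n.
Proof.
rewrite /hom_eval big_ord_recr/= big1 ?add0r => [|i _].
  by rewrite hom_monomial0 subnn expr1n !mulr1.
by rewrite hom_monomial0 subrr expr0n subn_eq0 leqNgt ltn_ord mulr0 mulr0.
Qed.

(** For [s < 1] the value is [(1 - s) ^+ n] times [p] at the nonnegative point [s / (1 - s)]; at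
    [s = 1] only the coefficient of degree [n] survives. *)
Lemma hom_eval_gt0 (R : realFieldType) n (p : {poly R}) :
  (size p <= n.+1)%N -> (forall x, 0 <= x -> 0 < p.[x]) -> 0 < p`_n ->
  forall s, 0 <= s -> s <= 1 -> 0 < hom_eval n p s 0.
Proof.
move=> szp p_gt0 pn_gt0 s s0; rewrite le_eqVlt => /predU1P[->|s1].
  by rewrite hom_eval_at1.
have s1' : 0 < 1 - s by rewrite subr_gt0.
rewrite hom_eval_lt1 ?gt_eqF// mulr_gt0 ?exprn_gt0// p_gt0//.
by rewrite divr_ge0// ltW.
Qed.

(** * Positivity of the unperturbed polynomial on the closed square *)

Section Positivity.
Variables (R : realType) (f : {poly {poly R}}).
Hypothesis f_gt0 : forall x y : R, 0 <= x -> 0 <= y -> 0 < f.[x, y].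
Hypothesis f_inftyX_gt0 : forall y : R, 0 <= y -> 0 < (at_inftyX f).[y].
Hypothesis f_inftyY_gt0 : forall x : R, 0 <= x -> 0 < (at_inftyY f).[x].
Hypothesis f_inftyXY_gt0 : 0 < at_inftyXY f.

Let size_f : (size f <= (degX f).+1)%N.
Proof. exact: leqSpred. Qed.

Let size_coef_f i : (size (f`_i)%R <= (degY f).+1)%N.
Proof. exact: leq_trans (max_size_coefXY _ _) (leqSpred _). Qed.

Let size_inftyY : (size (at_inftyY f) <= (degX f).+1)%N.
Proof.
apply: leq_trans (max_size_coefXY _ _) _.
by rewrite sizeYE swapXYK size_f.
Qed.

(** Fixing [t] reduces to one variable. At [t = 1] the polynomial in x is [at_inftyY f], with top
    coefficient [at_inftyXY f]. For [t < 1] it is, up to a positive factor, f(x, tau), with top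
    coefficient [(at_inftyX f).[tau]]. *)
Lemma hom_eval2_gt0 (s t : R) : 0 <= s -> s <= 1 -> 0 <= t -> t <= 1 ->
  0 < hom_eval2 (degX f) (degY f) f s t 0.
Proof.
move=> s0 s1 t0; rewrite le_eqVlt => /predU1P[->|t1].
  have -> : hom_eval2 (degX f) (degY f) f s 1 0 =
            hom_eval (degX f) (at_inftyY f) s 0.
    by apply: eq_bigr => i _; rewrite hom_eval_at1 coef_swapXY.
  by apply: hom_eval_gt0 => //; rewrite coef_swapXY.
have t1' : 0 < 1 - t by rewrite subr_gt0.
pose tau := t / (1 - t).
have tau0 : 0 <= tau by rewrite divr_ge0// ltW.
have -> : hom_eval2 (degX f) (degY f) f s t 0 = (1 - t) ^+ degY f *
            hom_eval (degX f) (map_poly (horner_eval tau) f) s 0.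
  rewrite mulr_sumr; apply: eq_bigr => i _.
  by rewrite (hom_eval_lt1 _ _ _ _ (size_coef_f i)) ?gt_eqF// coef_map -mulrA.
rewrite mulr_gt0 ?exprn_gt0//; apply: hom_eval_gt0 => //.
- exact: leq_trans (size_poly _ _) size_f.
(* [f.[x, tau]] substitutes x first, the mapped polynomial tau first; the two agree because
   evaluation at [tau] is a ring morphism fixing the constant [x%:P]. *)
- move=> x x0; have <- : f.[x, tau] = (map_poly (horner_eval tau) f).[x].
    by rewrite -[in RHS](hornerC x tau) -[_%:P.[_]]/(horner_eval tau x%:P) horner_map.
  exact: f_gt0.
- by rewrite coef_map; apply: f_inftyX_gt0.
Qed.

End Positivity.

(** * Joint continuity and compactness *)

Local Open Scope classical_set_scope.

Lemma continuous_hom_monomial {R : realType} {T : topologicalType}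
    (g h : T -> R) n i :
  continuous g -> continuous h ->
  continuous (fun x => hom_monomial n i (g x) (h x)).
Proof.
move=> cg ch x; have cprod k (g' : T -> R) : {for x, continuous g'} ->
    \prod_(u < k) (g' y - u%:R * h y) @[y --> x] -->
    \prod_(u < k) (g' x - u%:R * h x).
  move=> cg'; apply: cvg_big => [|u _]; first exact: mul_continuous.
  by apply: cvgB => //; apply: cvgMr; exact: ch.
apply: cvgM; apply: cprod; first exact: cg.
by apply: cvgB; [exact: cvg_cst | exact: cg].
Qed.

Lemma continuous_hom_eval2 {R : realType} n1 n2 (f : {poly {poly R}}) :
  continuous (fun z : R * R * R => hom_eval2 n1 n2 f z.1.1 z.1.2 z.2).
Proof.
have c2 : continuous (fun z : R * R * R => z.2) by move=> z; exact: cvg_snd.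
have c11 : continuous (fun z : R * R * R => z.1.1).
  by move=> z; apply: cvg_comp; [exact: cvg_fst | exact: cvg_fst].
have c12 : continuous (fun z : R * R * R => z.1.2).
  by move=> z; apply: cvg_comp; [exact: cvg_fst | exact: cvg_snd].
move=> z; apply: cvg_big => [|i _]; first exact: add_continuous.
apply: cvgM; last exact: (continuous_hom_monomial _ _ n1 i c11 c2 z).
apply: cvg_big => [|j _]; first exact: add_continuous.
by apply: cvgMr; exact: (continuous_hom_monomial _ _ n2 j c12 c2 z).
Qed.

(** By joint continuity at [(s, t, 0)], positivity persists for nearby points and small steps;
    compactness of the square makes the bound on the step uniform. *)
Lemma hom_eval2_gt0_near {R : realType} n1 n2 (f : {poly {poly R}}) :
  (forall s t : R, 0 <= s -> s <= 1 -> 0 <= t -> t <= 1 ->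
    0 < hom_eval2 n1 n2 f s t 0) ->
  \forall e \near (0 : R), forall s t : R,
    0 <= s -> s <= 1 -> 0 <= t -> t <= 1 -> 0 < hom_eval2 n1 n2 f s t e.
Proof.
move=> F_gt0.
have /compact_near_coveringP cov : compact (`[0 : R, 1] `*` `[0 : R, 1]).
  by apply: compact_setX; exact: segment_compact.
have := cov R (nbhs (0 : R)) (fun e z => 0 < hom_eval2 n1 n2 f z.1 z.2 e) _.
move=> /(_ _) []; last first.
  move=> d d0 H; exists d => // e /H sub s t s0 s1 t0 t1.
  by apply: (sub (s, t)); split; rewrite /= in_itv/= ?s0 ?t0.
move=> [s t] [/=]; rewrite !in_itv/= => /andP[s0 s1] /andP[t0 t1].
have := @continuous_hom_eval2 R n1 n2 f (s, t, 0).
move=> /cvgr_gt /(_ 0 (F_gt0 _ _ s0 s1 t0 t1)).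
exact.
Qed.

Local Close Scope classical_set_scope.

(** * Coefficients of the product with the multiplier *)

Lemma coef_X1n {R : nzRingType} N k :
  (('X + 1) ^+ N : {poly R})`_k = 'C(N, k)%:R.
Proof.
rewrite exprD1n coef_sum; have [kN|Nk] := leqP k N.
  rewrite (bigD1 (Ordinal (kN : (k < N.+1)%N)))//= coefMn coefXn eqxx.
  rewrite big1 ?addr0// => i; rewrite -val_eqE/= => ik.
  by rewrite coefMn coefXn eq_sym (negPf ik) mul0rn.
rewrite bin_small// big1// => i _.
by rewrite coefMn coefXn gtn_eqF ?mul0rn// (leq_trans (ltn_ord i)).
Qed.

(** This is the coefficient of x^k in x^i (1 + x)^N. The test is needed since for [k < i] truncated
    subtraction would give ['C(N, 0) = 1]. *)
Definition shifted_bin (N i k : nat) : nat := if (k < i)%N then 0 else 'C(N, k - i).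

Lemma coefM_X1n {R : nzRingType} n N (p : {poly R}) k : (size p <= n)%N ->
  (p * ('X + 1) ^+ N)`_k = \sum_(i < n) p`_i * (shifted_bin N i k)%:R.
Proof.
move=> szp; rewrite {1}(_ : p = \sum_(i < n) p`_i *: 'X^i); last first.
  by rewrite -poly_def; apply/polyP => i; rewrite coef_poly; case: ltnP => // ni;
    rewrite nth_default// (leq_trans szp).
rewrite mulr_suml coef_sum; apply: eq_bigr => i _.
rewrite -scalerAl coefZ coefXnM /shifted_bin; congr (_ * _).
by case: ifP => //; rewrite coef_X1n.
Qed.

Lemma shifted_bin_gt N n i k : (i <= n)%N -> (N + n < k)%N ->
  shifted_bin N i k = 0%N.
Proof. by move=> ? ?; rewrite /shifted_bin bin_small ?if_same//; lia. Qed.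

(** When [i <= k <= N + i], split each factorial on the left into a falling factorial and a
    remainder; the remainders [(k - i)!] and [(N - (k - i))!] turn the binomial into [N!]. Otherwise
    both sides vanish. *)
Lemma shifted_bin_fact N n i k : (i <= n)%N -> (k <= N + n)%N ->
  (shifted_bin N i k * (k`! * (N + n - k)`!) =
   N`! * (k ^_ i * (N + n - k) ^_ (n - i)))%N.
Proof.
move=> le_in le_k; rewrite /shifted_bin; case: ltnP => [lt_ki|le_ik].
  by rewrite mul0n ffact_small// mul0n muln0.
have [le_N|lt_N] := leqP (k - i) N; last first.
  by rewrite bin_small// (@ffact_small (N + n - k)) ?muln0 ?mul0n//; lia.
rewrite -(ffact_fact le_ik).
rewrite -(@ffact_fact (N + n - k) (n - i)); last by lia.
rewrite -(bin_fact le_N) (_ : N + n - k - (n - i) = N - (k - i))%N; last by lia.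
by lia.
Qed.

Lemma ffact_prod {R : fieldType} (m k i : nat) : m%:R != 0 :> R ->
  (k ^_ i)%:R = m%:R ^+ i * \prod_(u < i) (k%:R / m%:R - u%:R * m%:R^-1) :> R.
Proof.
move=> m0; elim: i => [|i IH]; first by rewrite big_ord0 mulr1.
rewrite ffactnSr big_ord_recr/= natrM IH exprSr.
have [le_ik|lt_ki] := leqP i k; first by rewrite natrB//; field.
(* Here [k - i] is truncated, but the induction hypothesis shows that the product up to [i] is
   already zero. *)
move: IH; rewrite ffact_small// => /esym/eqP;
  rewrite mulf_eq0 expf_eq0 (negPf m0) andbF.
by move=> /eqP ->; rewrite mul0r !mulr0 mul0r.
Qed.

Lemma hom_monomial_ffact {R : fieldType} (m n i k : nat) :
  m%:R != 0 :> R -> (i <= n)%N -> (k <= m)%N ->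
  (k ^_ i * (m - k) ^_ (n - i))%:R =
  m%:R ^+ n * hom_monomial n i (k%:R / m%:R) m%:R^-1 :> R.
Proof.
move=> m0 le_in le_km; rewrite natrM !(ffact_prod _ _ _ m0) natrB// mulrBl divff//.
by rewrite mulrACA -exprD subnKC.
Qed.

Lemma shifted_bin_hom_monomial {R : fieldType} (m N n i k : nat) :
  m%:R != 0 :> R -> (N + n = m)%N -> (i <= n)%N -> (k <= m)%N ->
  (shifted_bin N i k)%:R * (k`! * (m - k)`!)%:R =
  (N`!)%:R * m%:R ^+ n * hom_monomial n i (k%:R / m%:R) m%:R^-1 :> R.
Proof.
move=> m0 Nn le_in le_km.
by rewrite -natrM -Nn shifted_bin_fact ?Nn// natrM hom_monomial_ffact// mulrA.
Qed.

Lemma coef_mul_X1n_Y1n {R : nzRingType} n1 n2 N1 N2 (f : {poly {poly R}}) k l :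
  (size f <= n1.+1)%N -> (forall i, size (f`_i)%R <= n2.+1)%N ->
  (f * (('X + 1) ^+ N1 * (('X + 1) ^+ N2)%:P))`_k`_l =
  \sum_(i < n1.+1) (\sum_(j < n2.+1) f`_i`_j * (shifted_bin N2 j l)%:R)
    * (shifted_bin N1 i k)%:R.
Proof.
move=> szf szfi; rewrite mulrA coefMC (coefM_X1n _ _ _ _ szf) mulr_suml coef_sum.
apply: eq_bigr => i _; rewrite -mulrA [X in _ * X]mulr_natl mulrnAr coefMn.
by rewrite -(coefM_X1n _ _ _ _ (szfi i)) mulr_natr.
Qed.

(** Beyond degree [m] in x or y the coefficients vanish. Below it, multiplying by the positive
    factorials [D2 * D1] gives a positive multiple of the perturbed polynomial at [(k/m, l/m)], a
    point of the square. *)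
Lemma nneg_coefs_mul_X1n_Y1n {R : realType} m n1 n2 N1 N2 (f : {poly {poly R}}) :
  (0 < m)%N -> (N1 + n1 = m)%N -> (N2 + n2 = m)%N ->
  (size f <= n1.+1)%N -> (forall i, size (f`_i)%R <= n2.+1)%N ->
  (forall s t : R, 0 <= s -> s <= 1 -> 0 <= t -> t <= 1 ->
    0 < hom_eval2 n1 n2 f s t m%:R^-1) ->
  nneg_coefs (f * (('X + 1) ^+ N1 * (('X + 1) ^+ N2)%:P)).
Proof.
move=> m_gt0 Nn1 Nn2 szf szfi F_gt0 k l; rewrite (coef_mul_X1n_Y1n n1 n2)//.
have [le_km|lt_mk] := leqP k m; last first.
  rewrite big1// => i _.
  by rewrite (shifted_bin_gt N1 n1 i) ?Nn1// ?mulr0// -ltnS.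
have [le_lm|lt_ml] := leqP l m; last first.
  rewrite big1// => i _; rewrite big1 ?mul0r// => j _.
  by rewrite (shifted_bin_gt N2 n2 j) ?Nn2// ?mulr0// -ltnS.
have m0 : m%:R != 0 :> R by rewrite pnatr_eq0 -lt0n.
set c := \sum_(i < _) _.
pose D1 : R := (k`! * (m - k)`!)%:R; pose D2 : R := (l`! * (m - l)`!)%:R.
have D_gt0 : 0 < D2 * D1 by rewrite mulr_gt0 ?ltr0n ?muln_gt0 ?fact_gt0.
rewrite -(pmulr_lge0 _ D_gt0).
suff -> : c * (D2 * D1) = ((N2`!)%:R * m%:R ^+ n2) * ((N1`!)%:R * m%:R ^+ n1) *
    hom_eval2 n1 n2 f (k%:R / m%:R) (l%:R / m%:R) m%:R^-1.
  rewrite mulr_ge0 ?mulr_ge0 ?exprn_ge0 ?ler0n// ltW//.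
  by apply: F_gt0; rewrite ?divr_ge0 ?ler0n// ler_pdivrMr ?ltr0n// mul1r ler_nat.
rewrite mulr_suml mulr_sumr; apply: eq_bigr => i _.
rewrite mulrACA (shifted_bin_hom_monomial _ _ _ _ _ m0 Nn1)//; last by rewrite -ltnS.
rewrite [RHS]mulrACA; congr (_ * _).
rewrite mulr_suml mulr_sumr; apply: eq_bigr => j _.
rewrite -mulrA (shifted_bin_hom_monomial _ _ _ _ _ m0 Nn2)//; last by rewrite -ltnS.
by rewrite mulrCA.
Qed.

Theorem mainTheorem2 (R : realType) (f : {poly {poly R}})
  (f_gt0 : forall x y : R, 0 <= x -> 0 <= y -> 0 < f.[x, y])
  (f_inftyX_gt0 : forall y : R, 0 <= y -> 0 < (at_inftyX f).[y])
  (f_inftyY_gt0 : forall x : R, 0 <= x -> 0 < (at_inftyY f).[x])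
  (f_inftyXY_gt0 : 0 < at_inftyXY f) :
  exists f1 f2 : {poly {poly R}},
    [/\ nneg_coefs f1, nneg_coefs f2, f1 != 0
      & f%:F = f2%:F / f1%:F :> {fraction {poly {poly R}}}].
Proof.
have F_gt0 := hom_eval2_gt0 R f f_gt0 f_inftyX_gt0 f_inftyY_gt0 f_inftyXY_gt0.
(* The steps [1/(n + 1)] tend to 0, so positivity holds for all [n] from some [M] on. *)
have /cvg_harmonic[M _ F_gt0_m] := hom_eval2_gt0_near _ _ f F_gt0.
(* [m.-1 >= M] makes the step [1/m] small enough; the two degrees enter so that the exponents
   [m - degX f] and [m - degY f] are not truncated. *)
pose m := (maxn M (maxn (degX f) (degY f))).+1.
have F_gt0_inv : forall s t : R, 0 <= s -> s <= 1 -> 0 <= t -> t <= 1 ->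
    0 < hom_eval2 (degX f) (degY f) f s t m%:R^-1.
  by apply: (F_gt0_m m.-1); rewrite /= leq_maxl.
pose N1 := (m - degX f)%N; pose N2 := (m - degY f)%N.
pose f1 : {poly {poly R}} := ('X + 1) ^+ N1 * (('X + 1) ^+ N2)%:P.
have f1_neq0 : f1 != 0.
  by rewrite mulf_neq0 ?polyC_eq0// expf_neq0// -polyC1 monic_neq0 ?monicXaddC.
exists f1, (f * f1); split => //.
- move=> i j; rewrite coefMC coef_X1n mulr_natl coefMn coef_X1n.
  by rewrite mulrn_wge0// ler0n.
- apply: (@nneg_coefs_mul_X1n_Y1n _ m (degX f) (degY f)) => //.
  + by rewrite subnK//; lia.
  + by rewrite subnK//; lia.
  + exact: leqSpred.
  + by move=> i; exact: leq_trans (max_size_coefXY _ _) (leqSpred _).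
- by rewrite tofracM mulfK// tofrac_eq0.
Qed.
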